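(* Let $P$ and $Q$ be rational $d$-dimensional polytopes in $\mathbb{R}^d$ such that the normal fan $\mathcal{N}(P)$ is a refinement of $\mathcal{N}(Q)$, and such that $\ell(e_P)\geq d\cdot\ell(e_Q)$ for every edge $e_P$ of $P$ whose image $e_Q=\Phi(e_P)$ is an edge of $Q$. Then the pair $(Q,P)$ is convex-normal, i.e. $Q+P=G(Q)+P$.
   Context: A rational polytope is the convex hull of finitely many points of $\mathbb{Q}^d$. For a polytope $Q$ with vertex set $\mathrm{ver}(Q)$ set $G(Q):=\bigcup_{v\in\mathrm{ver}(Q)}\big((v+\mathbb{Z}^d)\cap Q\big)$. A pair $(Q,P)$ is convex-normal if $Q+P=G(Q)+P$ (Minkowski sums). For a nonempty face $F$ of a polytope $P$, its normal cone is $C_F=\{c: \{z: c^tz=\max_{x\in P}c^tx\}\supseteq F\}$ (intersected with $P$); the normal fan $\mathcal{N}(P)$ is the collection of these cones, and $F\mapsto C_F$ is an inclusion-reversing bijection. $\mathcal{N}(P)$ refines $\mathcal{N}(Q)$ if every cone of $\mathcal{N}(P)$ is contained in some cone of $\mathcal{N}(Q)$. In that case, for a face $F$ of $P$, $\Phi(F)$ denotes the face $G$ of $Q$ whose normal cone $C_G$ is the smallest cone of $\mathcal{N}(Q)$ containing $C_F$. Lattice length: for an edge with edge vector $e=w-v$, let $u$ be the primitive integer vector on the line spanned by $w-v$; then $e=ku$ and $\ell(e):=|k|$. *)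

(* Defs.v *)
From mathcomp Require Import all_boot all_order all_algebra.
From mathcomp Require Import boolp classical_sets reals.

Set Implicit Arguments.
Unset Strict Implicit.
Unset Printing Implicit Defensive.

Import Order.TTheory GRing.Theory Num.Theory.

Local Open Scope classical_set_scope.
Local Open Scope ring_scope.

Section Polytopes.
Variables (R : realType) (d : nat).
Implicit Types (A B P Q F G E : set 'rV[R]_d) (c x v w : 'rV[R]_d).

Definition dot c x : R := \sum_i c 0 i * x 0 i.

Definition minkowski_sum A B : set 'rV[R]_d :=
  [set x + y | x in A & y in B].

Definition conv_hull A : set 'rV[R]_d :=
  [set x | exists (n : nat) (p : 'I_n -> 'rV[R]_d) (a : 'I_n -> R),
    [/\ forall i, A (p i), forall i, 0 <= a i,
        \sum_i a i = 1 & x = \sum_i a i *: p i]].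

Definition aff_hull A : set 'rV[R]_d :=
  [set x | exists (n : nat) (p : 'I_n -> 'rV[R]_d) (a : 'I_n -> R),
    [/\ forall i, A (p i), \sum_i a i = 1 & x = \sum_i a i *: p i]].

(* The affine hull of A is a translate of a k-dimensional linear subspace,
   given as the row space of U; in particular A is nonempty. *)
Definition has_dim A (k : nat) : Prop :=
  exists (p : 'rV[R]_d) (U : 'M[R]_d),
    \rank U = k /\ aff_hull A = [set p + u | u in [set u | (u <= U)%MS]].

Definition rational_polytope P : Prop :=
  exists s : seq 'rV[rat]_d, P = conv_hull [set map_mx ratr q | q in [set` s]].

(* The part of P lying in {z : c^t z = max_(x in P) c^t x}. *)
Definition max_face P c : set 'rV[R]_d :=
  [set z | P z /\ forall x, P x -> dot c x <= dot c z].

(* Nonempty faces; P itself is the face obtained for c = 0. *)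
Definition face P F : Prop := F !=set0 /\ exists c, F = max_face P c.

Definition vertices P : set 'rV[R]_d := [set v | face P [set v]].

Definition edge P E : Prop := face P E /\ has_dim E 1.

Definition normal_cone P F : set 'rV[R]_d := [set c | F `<=` max_face P c].

Definition normal_fan P : set (set 'rV[R]_d) :=
  [set C | exists2 F, face P F & C = normal_cone P F].

Definition refines (N M : set (set 'rV[R]_d)) : Prop :=
  forall C, N C -> exists2 D, M D & C `<=` D.

(* The face G of Q whose normal cone is the least cone of the normal fan of Q
   containing the normal cone of F.  It is unique, and it exists as soon as the
   normal fan of P refines that of Q; set0 is a default, not a face. *)
Definition Phi P Q F : set 'rV[R]_d :=
  xget set0 [set G | [/\ face Q G,
    normal_cone P F `<=` normal_cone Q G &
    forall D, normal_fan Q D -> normal_cone P F `<=` D ->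
      normal_cone Q G `<=` D]].

Definition int_vec (u : 'rV[int]_d) : 'rV[R]_d := map_mx intr u.

Definition primitive (u : 'rV[int]_d) : Prop :=
  \big[gcdn/0%N]_i `|u 0%R i|%N = 1%N.

(* For a segment E = [v, w] with w - v = k u and u primitive, this is |k|.
   It does not depend on the choices of v, w, u and k, which always exist for
   an edge of a rational polytope. *)
Definition lattice_length E : R :=
  xget 0 [set l | exists v w (u : 'rV[int]_d) (k : R),
    [/\ E = conv_hull [set v; w], primitive u,
        w - v = k *: int_vec u & l = `|k|]].

Definition lattice_points_from_vertices Q : set 'rV[R]_d :=
  \bigcup_(v in vertices Q) ([set v + int_vec u | u in setT] `&` Q).

Definition convex_normal Q P : Prop :=
  minkowski_sum Q P = minkowski_sum (lattice_points_from_vertices Q) P.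

End Polytopes.

(* Main.v *)
Require Import Defs.
From mathcomp Require Import all_boot all_order all_algebra.
From mathcomp Require Import boolp classical_sets reals.
From mathcomp Require Import ring lra.

(** The length condition forces [d Q] to be a Minkowski summand of [P]
    (Shephard's criterion).  Send each vertex [p] of [P] to the vertex [q p] of
    [Q] whose normal cone contains that of [p], and put [r p := p - d *: q p].
    Along an edge [p, p'] of [P] one has [q p' - q p = t *: (p' - p)] with
    [d * t <= 1], so [r p' - r p] is a nonnegative multiple of [p' - p].  Hence,
    for generic [c], [dot c \o r] grows along [c]-increasing edge paths and is
    maximal at the [c]-maximal vertex of [P]; by separation,
    [r p + d Q] lies in [P].  Thus [P = conv (r p) + d Q].  By Caratheodory, every
    point of [(d + 1) Q] is in [v + d Q] for some vertex [v] of [Q], so that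
    already [Q + P] is contained in [vertices Q + P]. *)

Set Implicit Arguments.
Unset Strict Implicit.
Unset Printing Implicit Defensive.

Import Order.TTheory GRing.Theory Num.Theory.
Local Open Scope classical_set_scope.
Local Open Scope ring_scope.


(** * Maxima over finite lists *)

Lemma seq_argmax (R : realType) (T : eqType) (f : T -> R) (s : seq T) (x0 : T) : x0 \in s ->
  exists2 x, x \in s & forall y, y \in s -> f y <= f x.
Proof.
elim: s x0 => // z s IH x0 _; case: s IH => [_|t s IH].
  by exists z; rewrite ?inE// => y; rewrite inE => /eqP->.
have [x xs xm] := IH t (mem_head _ _).
have [zx|xz] := leP (f z) (f x).
  by exists x; [rewrite inE xs orbT|move=> y; rewrite inE => /orP[/eqP->|/xm]].
exists z; first exact: mem_head.
by move=> y; rewrite inE => /orP[/eqP->//|/xm yx]; apply: le_trans yx (ltW xz).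
Qed.

(** * Separation in R^d *)

Section DotProduct.
Variables (R : realType) (d : nat).
Implicit Types (c u v w x y : 'rV[R]_d) (us ws : seq 'rV[R]_d).

Lemma dotC c x : dot c x = dot x c.
Proof. by apply: eq_bigr => i _; rewrite mulrC. Qed.

Lemma dotDr c x y : dot c (x + y) = dot c x + dot c y.
Proof. by rewrite -big_split; apply: eq_bigr => i _; rewrite mxE mulrDr. Qed.

Lemma dotZr k c x : dot c (k *: x) = k * dot c x.
Proof. by rewrite mulr_sumr; apply: eq_bigr => i _; rewrite mxE mulrCA. Qed.

Lemma dotNr c x : dot c (- x) = - dot c x.
Proof. by rewrite -scaleN1r dotZr mulN1r. Qed.

Lemma dotBr c x y : dot c (x - y) = dot c x - dot c y.
Proof. by rewrite dotDr dotNr. Qed.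

Lemma dot0r c : dot c 0 = 0.
Proof. by rewrite -(scale0r 0) dotZr mul0r. Qed.

Lemma dotDl c u x : dot (c + u) x = dot c x + dot u x.
Proof. by rewrite ![dot _ x]dotC dotDr. Qed.

Lemma dotZl k c x : dot (k *: c) x = k * dot c x.
Proof. by rewrite ![dot _ x]dotC dotZr. Qed.

Lemma dotBl c u x : dot (c - u) x = dot c x - dot u x.
Proof. by rewrite ![dot _ x]dotC dotBr. Qed.

Lemma dotNl c x : dot (- c) x = - dot c x.
Proof. by rewrite ![dot _ x]dotC dotNr. Qed.

Definition dotE := (dotDr, dotNr, dotZr, dotDl, dotNl, dotZl).

Lemma dot_sumr c n (a : 'I_n -> R) (p : 'I_n -> 'rV[R]_d) :
  dot c (\sum_i a i *: p i) = \sum_i a i * dot c (p i).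
Proof.
elim/big_ind2: _ => [|x k y l <- <-|i _]; first exact: dot0r.
  exact: dotDr.
exact: dotZr.
Qed.

Lemma dotvv_gt0 x : x != 0 -> 0 < dot x x.
Proof.
move=> x0; rewrite lt_def sumr_ge0 ?andbT; last by move=> i _; rewrite -expr2 sqr_ge0.
apply: contra x0 => /eqP xx0; apply/eqP/rowP => i; rewrite mxE.
apply/eqP; rewrite -sqrf_eq0 expr2; apply/eqP.
by apply: (psumr_eq0P _ xx0) => // j _; rewrite -expr2 sqr_ge0.
Qed.

(** The remainder of [y] after projection onto [u] is orthogonal to [u], hence by hypothesis to [y],
    hence to itself, so it vanishes. *)
Lemma orth_orth_colinear u y :
  u != 0 -> (forall w, dot w u = 0 -> dot w y = 0) -> exists t, y = t *: u.
Proof.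
move=> u0 uy; have uu := dotvv_gt0 u0; exists (dot y u / dot u u).
apply/eqP; rewrite -subr_eq0; apply/negPn/negP => /dotvv_gt0.
have wu : dot (y - (dot y u / dot u u) *: u) u = 0.
  by rewrite !dotE divfK ?gt_eqF// subrr.
by rewrite dotBr dotZr wu uy// mulr0 subrr ltxx.
Qed.

Lemma small_perturbation us c e : (forall u, u \in us -> 0 < dot c u) ->
  exists2 t, 0 < t & forall u, u \in us -> 0 < dot (c + t *: e) u.
Proof.
elim: us => [_|u us IH cu]; first by exists 1.
have [|t t0 tu] := IH; first by move=> v vu; apply: cu; rewrite inE vu orbT.
have cu0 : 0 < dot c u by apply: cu; exact: mem_head.
(* The term with [|dot e u|] keeps the change of [dot c u] along [(t / m) *: e] below [dot c u].
   Since [1 <= m], the step only shrinks, and positivity on [us] at both [0] and [t] persists in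
   between. *)
pose m := 1 + t + `|dot e u| / dot c u * t.
have e0 : 0 <= `|dot e u| / dot c u * t.
  by rewrite mulr_ge0 ?divr_ge0 ?normr_ge0 ?ltW.
have m0 : 0 < m by rewrite /m; lra.
exists (t / m); first exact: divr_gt0.
have tm : t / m <= t by rewrite ler_pdivrMr// ler_peMr ?ltW// /m; lra.
move=> v; rewrite inE => /orP[/eqP->|vus].
  have -> : dot (c + (t / m) *: e) u =
      (dot c u * (1 + t) + (`|dot e u| + dot e u) * t) / m.
    have e1 : `|dot e u| * t = (m - 1 - t) * dot c u.
      by rewrite /m; field; exact: lt0r_neq0.
    by rewrite dotDl dotZl [(_ + dot e u) * t]mulrDl e1; field; exact: lt0r_neq0.
  rewrite divr_gt0// ltr_pwDl//; first by rewrite mulr_gt0// ltr_wpDr// ltW.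
  have : - dot e u <= `|dot e u| by rewrite -normrN ler_norm.
  by move=> h; rewrite mulr_ge0 ?(ltW t0)//; lra.
have cv : 0 < dot c v by apply: cu; rewrite inE vus orbT.
have := tu v vus; rewrite !dotDl !dotZl => h.
have [ev|ev] := leP 0 (dot e v).
  by rewrite ltr_wpDr// mulr_ge0// ltW// divr_gt0.
have : t * dot e v <= t / m * dot e v by rewrite ler_wnM2r// ltW.
by lra.
Qed.

Lemma generic_perturbation us ws c : (forall u, u \in us -> 0 < dot c u) ->
  exists2 c', forall u, u \in us -> 0 < dot c' u &
    forall w, w \in ws -> w != 0 -> dot c' w != 0.
Proof.
elim: ws us c => [us c cu|w ws IH us c cu]; first by exists c.
have [->|w0] := eqVneq w 0.
  have [c' c'u c'w] := IH us c cu; exists c' => // v.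
  by rewrite inE => /orP[/eqP->|/c'w//]; rewrite eqxx.
have [c1 c1u c1w] : exists2 c1, forall u, u \in us -> 0 < dot c1 u & dot c1 w != 0.
  have [cw|cw] := eqVneq (dot c w) 0; last by exists c.
  have [t t0 tu] := small_perturbation w cu; exists (c + t *: w) => //.
  by rewrite !dotE cw add0r gt_eqF// mulr_gt0// dotvv_gt0.
(* On [dot c1 w *: w] the functional [c1] takes the value [dot c1 w] squared. Keeping this vector in
   the positive list makes later perturbations nonzero on [w]. *)
have [|c' c'u c'w] := IH (dot c1 w *: w :: us) c1.
  move=> u; rewrite inE => /orP[/eqP->|/c1u//].
  by rewrite dotZr -expr2 exprn_even_gt0.
exists c' => [u uus|v]; first by apply: c'u; rewrite inE uus orbT.
rewrite inE => /orP[/eqP-> _|]; last exact: c'w.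
have := c'u _ (mem_head _ _); rewrite dotZr.
by apply: contraTneq => ->; rewrite mulr0 ltxx.
Qed.

Lemma wavg_gt0 n (a f : 'I_n -> R) : (forall i, 0 <= a i) -> \sum_i a i = 1 ->
  (forall i, 0 < f i) -> 0 < \sum_i a i * f i.
Proof.
move=> a0 a1 f0; have af0 i : true -> 0 <= a i * f i by rewrite mulr_ge0 // ltW.
rewrite lt_def sumr_ge0// andbT; apply/eqP => /psumr_eq0P h.
have : \sum_i a i = 0.
  apply: big1 => i _; have /eqP := h af0 i isT.
  by rewrite mulf_eq0 (gt_eqF (f0 i)) orbF => /eqP.
by rewrite a1 => /eqP; rewrite oner_eq0.
Qed.

Lemma wavg_le n (a f : 'I_n -> R) m : (forall i, 0 <= a i) -> \sum_i a i = 1 ->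
  (forall i, f i <= m) -> \sum_i a i * f i <= m.
Proof.
move=> a0 a1 fm; rewrite -[leRHS]mul1r -a1 mulr_suml.
by apply: ler_sum => i _; rewrite ler_wpM2l.
Qed.

Let cons_ord n (a0 : R) (a : 'I_n -> R) i :=
  if unlift ord0 i is Some j then a j else a0.

(** Gordan's alternative, by induction on the number of vectors: when the functional found for the
    last [n] vectors fails on the first one, the others are projected along it and the induction
    hypothesis is used again. *)
Lemma gordan n (v : 'I_n -> 'rV[R]_d) :
  (exists a : 'I_n -> R,
     [/\ forall i, 0 <= a i, \sum_i a i = 1 & \sum_i a i *: v i = 0]) \/
  exists c, forall i, 0 < dot c (v i).
Proof.
elim: n v => [v|n IH v]; first by right; exists 0; case.
have consP (a0 : R) (a : 'I_n -> R) : 0 <= a0 -> (forall i, 0 <= a i) ->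
    0 < a0 + \sum_i a i ->
    a0 *: v ord0 + \sum_i a i *: v (lift ord0 i) = 0 ->
    exists a : 'I_n.+1 -> R,
     [/\ forall i, 0 <= a i, \sum_i a i = 1 & \sum_i a i *: v i = 0].
  move=> a0_ge0 a_ge0 s_gt0 sv; set s := a0 + _ in s_gt0.
  exists (fun i => s^-1 * cons_ord a0 a i); split.
  - move=> i; rewrite mulr_ge0 ?invr_ge0 ?(ltW s_gt0)// /cons_ord.
    by case: unliftP.
  - rewrite -mulr_sumr big_ord_recl /cons_ord unlift_none.
    under eq_bigr do rewrite liftK.
    by rewrite mulVf ?gt_eqF.
  - under eq_bigr do rewrite -scalerA.
    rewrite -scaler_sumr big_ord_recl /cons_ord unlift_none.
    under eq_bigr do rewrite liftK.
    by rewrite sv scaler0.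
have [[a [a_ge0 a1 av]]|[c cv]] := IH (fun i => v (lift ord0 i)).
  by left; apply: (consP 0 a); rewrite ?a1 ?add0r ?scale0r ?add0r.
have [c0|c0] := ltP 0 (dot c (v ord0)).
  by right; exists c => i; case: (unliftP ord0 i) => [j|] ->.
have [v0|v0] := eqVneq (v ord0) 0.
  left; apply: (consP 1 (fun=> 0)); rewrite ?big1 ?addr0 ?v0 ?scaler0//.
  by move=> i _; rewrite scale0r.
(* [x - k x *: v ord0] is the projection of [x] to the hyperplane orthogonal to [v ord0]. If the
   projections admit a vanishing convex combination, the vectors themselves combine to
   [m *: v ord0], and pairing with [c] shows [m < 0]. *)
have vv := dotvv_gt0 v0; pose k x := dot x (v ord0) / dot (v ord0) (v ord0).
have [[a [a_ge0 a1 av]]|[c' cv']] :=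
  IH (fun i => v (lift ord0 i) - k (v (lift ord0 i)) *: v ord0).
  left; pose m := \sum_i a i * k (v (lift ord0 i)).
  have am : \sum_i a i *: v (lift ord0 i) = m *: v ord0.
    move: av; under eq_bigr do rewrite scalerBr scalerA.
    by rewrite sumrB -scaler_suml => /subr0_eq.
  have m0 : m < 0.
    have := wavg_gt0 a_ge0 a1 cv; rewrite -dot_sumr am dotZr => h.
    by rewrite ltNge; apply/negP => m0; have := mulr_ge0_le0 m0 c0; lra.
  apply: (consP (- m) a) => //; first by rewrite oppr_ge0 ltW.
    by rewrite a1; lra.
  by rewrite am scaleNr addNr.
(* [c1] vanishes on [v ord0] and is positive on the other vectors; a small tilt towards [v ord0]
   makes it positive on all of them. *)
right; pose c1 := c' - k c' *: v ord0.
have c10 : dot c1 (v ord0) = 0 by rewrite !dotE /k divfK ?gt_eqF// subrr.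
have c1v i : dot c1 (v (lift ord0 i)) =
    dot c' (v (lift ord0 i) - k (v (lift ord0 i)) *: v ord0).
  rewrite !dotE /k (dotC (v ord0)); ring.
have [u|t t0 tu] :=
    small_perturbation (us := [seq v (lift ord0 i) | i <- enum 'I_n]) (c := c1) (v ord0).
  by move=> /mapP[i _ ->]; rewrite c1v.
exists (c1 + t *: v ord0) => i; case: (unliftP ord0 i) => [j|] ->.
  by apply: tu; apply: map_f; rewrite mem_enum.
by rewrite dotDl dotZl c10 add0r mulr_gt0.
Qed.

End DotProduct.


(** * Convex hulls and Caratheodory's theorem *)

Section ConvexHull.
Variables (R : realType) (d : nat).
Implicit Types (A B : set 'rV[R]_d) (S : seq 'rV[R]_d) (c p x y : 'rV[R]_d).

Lemma conv_hull_subset A B : A `<=` B -> conv_hull A `<=` conv_hull B.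
Proof.
move=> AB _ [n [p [a [pA a0 a1 ->]]]]; exists n, p, a; split=> // i.
exact: AB.
Qed.

Lemma subset_conv_hull A : A `<=` conv_hull A.
Proof.
move=> x Ax; exists 1%N, (fun=> x), (fun=> 1).
by split=> //; rewrite big_ord1 ?scale1r.
Qed.

Lemma conv_hull1 p : conv_hull [set p] = [set p].
Proof.
apply/seteqP; split=> [_ [n [q [a [qp a0 a1 ->]]]]|x ->]; last exact: subset_conv_hull.
under eq_bigr do rewrite qp.
by rewrite -scaler_suml a1 scale1r.
Qed.

Lemma conv_hull_nonempty A x : conv_hull A x -> A !=set0.
Proof.
move=> [[|n] [p [a [pA _ a1 _]]]]; last by exists (p ord0).
by move: a1; rewrite big_ord0 => /eqP; rewrite eq_sym oner_eq0.
Qed.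

Lemma conv_hull_le A c m x :
  (forall s, A s -> dot c s <= m) -> conv_hull A x -> dot c x <= m.
Proof.
move=> Am [n [p [a [pA a0 a1 ->]]]]; rewrite dot_sumr.
by apply: wavg_le => // i; apply: Am.
Qed.

Lemma conv_hull_exposed S c x :
  conv_hull [set` S] x -> exists2 s, s \in S & dot c x <= dot c s.
Proof.
move=> Sx; have [s0 s0S] := conv_hull_nonempty Sx.
have [s sS sm] := seq_argmax (dot c) s0S.
by exists s => //; apply: conv_hull_le Sx => t; apply: sm.
Qed.

(** Gordan's alternative for the vectors [x - s]: a vanishing convex combination of them would write
    [x] as a convex combination of [S]. *)
Lemma conv_hull_separation S x :
  ~ conv_hull [set` S] x -> exists c, forall s, s \in S -> 0 < dot c (x - s).
Proof.
have [[a [a0 a1 a_eq]] nx|[c cS] _] := gordan (fun i : 'I_(size S) => x - S`_i).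
  exfalso; apply: nx; exists (size S), (fun i => S`_i), a; split=> //.
    by move=> i; apply: mem_nth.
  move: a_eq; under eq_bigr do rewrite scalerBr.
  by rewrite sumrB -scaler_suml a1 scale1r => /subr0_eq.
exists c => s sS; rewrite -(nth_index 0 sS).
have sS' : (index s S < size S)%N by rewrite index_mem.
exact: (cS (Ordinal sS')).
Qed.

Lemma conv_hull2P (v w x : 'rV[R]_d) : conv_hull [set v; w] x <->
  exists2 t, 0 <= t <= 1 & x = v + t *: (w - v).
Proof.
split=> [[n [p [a [pvw a0 a1 ->]]]]|[t /andP[t0 t1] ->]].
  pose b i := if p i == v then 0 else 1 : R.
  exists (\sum_i a i * b i).
    apply/andP; split.
      by apply: sumr_ge0 => i _; rewrite mulr_ge0// /b; case: ifP.
    by apply: wavg_le => // i; rewrite /b; case: ifP.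
  rewrite -{1}[v]scale1r -a1 !scaler_suml -big_split; apply: eq_bigr => i _ /=.
  rewrite -scalerA -scalerDr /b; case: eqP => [->|pv].
    by rewrite scale0r addr0.
  by rewrite scale1r addrC subrK; case: (pvw i) => [/pv|->].
exists 2%N, (fun i => if i == ord0 then v else w),
  (fun i => if i == ord0 then 1 - t else t); split.
- by move=> i; case: ifP; [left|right].
- by move=> i; case: ifP; rewrite ?subr_ge0.
- by rewrite big_ord_recl big_ord1 /= subrK.
- rewrite big_ord_recl big_ord1 /= scalerBl scalerBr scale1r -!addrA; congr (_ + _).
  by rewrite addrC.
Qed.

(** Each difference of endpoints is a multiple of the other with factor in [[-1, 1]], and the two
    factors have product one. *)
Lemma conv_hull_endpoints (v w v' w' : 'rV[R]_d) : v != w ->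
  conv_hull [set v; w] = conv_hull [set v'; w'] ->
  exists2 e, `|e| = 1 & w' - v' = e *: (w - v).
Proof.
move=> vw E.
have /conv_hull2P[a /andP[a0 a1] v'E] : conv_hull [set v; w] v'.
  by rewrite E; apply: subset_conv_hull; left.
have /conv_hull2P[b /andP[b0 b1] w'E] : conv_hull [set v; w] w'.
  by rewrite E; apply: subset_conv_hull; right.
have /conv_hull2P[a' /andP[a'0 a'1] vE] : conv_hull [set v'; w'] v.
  by rewrite -E; apply: subset_conv_hull; left.
have /conv_hull2P[b' /andP[b'0 b'1] wE] : conv_hull [set v'; w'] w.
  by rewrite -E; apply: subset_conv_hull; right.
have e1 : w' - v' = (b - a) *: (w - v).
  by rewrite v'E w'E opprD addrACA subrr add0r scalerBl.
have e2 : w - v = (b' - a') *: (w' - v').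
  by rewrite {1}vE {1}wE opprD addrACA subrr add0r scalerBl.
exists (b - a) => //.
have h : (b' - a') * (b - a) = 1.
  apply/eqP; rewrite -subr_eq0.
  have : ((b' - a') * (b - a) - 1) *: (w - v) == 0.
    by rewrite scalerBl scale1r -scalerA -e1 -e2 subrr.
  by rewrite scaler_eq0 [w - v == 0]subr_eq0 [w == v]eq_sym (negPf vw) orbF.
have n1 : `|b - a| <= 1 by rewrite ler_norml; lra.
have n2 : `|b' - a'| <= 1 by rewrite ler_norml; lra.
apply/eqP; rewrite eq_le n1 /=.
have <- : `|b' - a'| * `|b - a| = 1 by rewrite -normrM h normr1.
by rewrite ler_piMl.
Qed.

(** The rows [(1, p i)] have [d + 1] columns, so more than [d + 1] of them have a nonzero left
    kernel vector. Its entries sum to zero, so one of them is positive. *)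
Lemma affine_dependence n (p : 'I_n -> 'rV[R]_d) : (d.+1 < n)%N ->
  exists m : 'I_n -> R, [/\ exists i, 0 < m i, \sum_i m i = 0 &
    \sum_i m i *: p i = 0].
Proof.
move=> dn; pose M : 'M[R]_(n, 1 + d) := row_mx (const_mx 1) (\matrix_i p i).
have : kermx M != 0.
  rewrite kermx_eq0 /row_free; apply: contraTneq dn => <-.
  by rewrite -leqNgt rank_leq_col.
move=> /rowV0Pn[v /sub_kermxP]; rewrite mul_mx_row -row_mx0 => /eq_row_mx[v1 vp] v0.
have s1 : \sum_i v 0 i = 0.
  move/matrixP: v1 => /(_ 0 0); rewrite !mxE => v1; rewrite -[RHS]v1.
  by apply: eq_bigr => i _; rewrite mxE mulr1.
have sp : \sum_i v 0 i *: p i = 0.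
  rewrite -[RHS]vp mulmx_sum_row; by apply: eq_bigr => i _; rewrite rowK.
exists (v 0); split=> //; apply: contrapT => npos; case/eqP: v0.
have v_le i : true -> 0 <= - v 0 i.
  by rewrite oppr_ge0 leNgt => _; apply/negP => h; apply: npos; exists i.
apply/rowP => i; rewrite mxE; apply/eqP; rewrite -oppr_eq0; apply/eqP.
by apply: (psumr_eq0P v_le) => //; rewrite sumrN s1 oppr0.
Qed.

(** In a representation with the fewest points, an affine dependence could be subtracted until some
    weight vanishes, and that point dropped. *)
Lemma caratheodory A x : conv_hull A x ->
  exists (n : nat) (p : 'I_n -> 'rV[R]_d) (a : 'I_n -> R), (n <= d.+1)%N /\
    [/\ forall i, A (p i), forall i, 0 <= a i,
        \sum_i a i = 1 & x = \sum_i a i *: p i].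
Proof.
pose rep n := exists (p : 'I_n -> 'rV[R]_d) (a : 'I_n -> R),
    [/\ forall i, A (p i), forall i, 0 <= a i,
        \sum_i a i = 1 & x = \sum_i a i *: p i].
move=> Ax; have ex : exists n, `[< rep n >].
  by have [n Hn] := Ax; exists n; apply/asboolP.
case: (ex_minnP ex) => n /asboolP[p [a [pA a0 a1 xE]]] nmin.
exists n, p, a; split=> //; rewrite leqNgt; apply/negP => dn.
have [m [[i0 mi0] m0 mp]] := affine_dependence p dn.
(* [k] minimises [a i / m i] over positive [m i]: this is the largest multiple of [m] whose
   subtraction keeps all weights nonnegative, and it cancels the weight of [k]. *)
have [|k] := @seq_argmax R _ (fun i => - (a i / m i)) [seq i <- enum 'I_n | 0 < m i] i0.
  by rewrite mem_filter mi0 mem_enum.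
rewrite mem_filter => /andP[mk _] kmin.
pose b i := a i - a k / m k * m i.
have b0 i : 0 <= b i.
  have [mi|mi] := leP (m i) 0.
    by rewrite subr_ge0 (le_trans _ (a0 i))// mulr_ge0_le0// divr_ge0// ltW.
  have := kmin i; rewrite mem_filter mi mem_enum => /(_ isT).
  by rewrite lerN2 ler_pdivlMr// subr_ge0.
have bk : b k = 0 by rewrite /b divfK ?gt_eqF ?subrr.
have b1 : \sum_i b i = 1 by rewrite sumrB -mulr_sumr m0 mulr0 subr0.
have bx : \sum_i b i *: p i = x.
  rewrite /b; under eq_bigr do rewrite scalerBl -scalerA.
  by rewrite sumrB -scaler_sumr mp scaler0 subr0.
have n0 : (0 < n)%N by case: (n) k {kmin mk bk b b0 b1 bx} => [[]|].
have : (n <= n.-1)%N; last by rewrite leqNgt prednK ?leqnn.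
apply: nmin; apply/asboolP; exists (fun j => p (lift k j)), (fun j => b (lift k j)).
split=> //.
  by rewrite -b1 (bigD1_ord k)//= bk add0r.
by rewrite -bx (bigD1_ord k)//= bk scale0r add0r.
Qed.

(** At most [d + 1] weights sum to one, so one of them is at least [1 / (d + 1)]. *)
Lemma caratheodory_weight A x : conv_hull A x ->
  exists (n : nat) (p : 'I_n -> 'rV[R]_d) (a : 'I_n -> R) (i0 : 'I_n),
    1 <= d.+1%:R * a i0 /\
    [/\ forall i, A (p i), forall i, 0 <= a i,
        \sum_i a i = 1 & x = \sum_i a i *: p i].
Proof.
move=> /caratheodory[n [p [a [nd [pA a0 a1 xE]]]]].
have [i0 ai0] : exists i, 1 <= d.+1%:R * a i.
  apply: contrapT => no.
  have n0 : n != 0%N.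
    apply/eqP => n0; subst n; move: a1; rewrite big_ord0 => /eqP.
    by rewrite eq_sym oner_eq0.
  have h i : d.+1%:R * a i < 1 by rewrite ltNge; apply/negP => h; apply: no; exists i.
  have : \sum_i (1 - d.+1%:R * a i) <= 0.
    by rewrite sumrB -mulr_sumr a1 mulr1 sumr_const card_ord subr_le0 ler_nat.
  case: n n0 p a nd pA a0 a1 xE no h => // n _ p a _ _ _ _ _ _ h.
  rewrite leNgt => /negP; apply; rewrite big_ord_recl ltr_pwDl ?subr_gt0//.
  by apply: sumr_ge0 => i _; rewrite subr_ge0 ltW.
by exists n, p, a, i0.
Qed.

End ConvexHull.

(** * Faces and vertices of a polytope *)

Section Polytope.
Variables (R : realType) (d : nat) (S : seq 'rV[R]_d).
Implicit Types (c p x y w : 'rV[R]_d).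
Let P := conv_hull [set` S].

Lemma conv_hull_max_le c x p :
  (forall s, s \in S -> dot c s <= dot c p) -> P x -> dot c x <= dot c p.
Proof. by move=> h; apply: conv_hull_le => s; apply: h. Qed.

(** A convex combination attains the maximum only if every generator of nonzero weight does. *)
Lemma max_face_conv_hull c : max_face P c =
  conv_hull [set s | s \in S /\ forall t, t \in S -> dot c t <= dot c s].
Proof.
apply/seteqP; split=> [x [Px xmax]|x].
  have [s sS xs] := conv_hull_exposed c Px.
  have sx : dot c s = dot c x.
    by apply/eqP; rewrite eq_le xs xmax//; exact: subset_conv_hull.
  have tmax t : t \in S -> dot c t <= dot c x.
    by move=> tS; apply: xmax; apply: subset_conv_hull.
  case: Px => n [p [a [pS a0 a1 xE]]].
  (* Points of weight zero may lie off the face; they are replaced by the maximising generator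
     [s]. *)
  exists n, (fun i => if a i == 0 then s else p i), a; split=> //.
    move=> i; case: eqP => [_|/eqP ai].
      by split=> // t tS; rewrite sx tmax.
    split=> [|t tS]; first exact: pS.
    suff -> : dot c (p i) = dot c x by exact: tmax.
    have /psumr_eq0P h : \sum_i a i * (dot c x - dot c (p i)) = 0.
      under eq_bigr do rewrite mulrBr.
      by rewrite sumrB -mulr_suml a1 mul1r -dot_sumr -xE subrr.
    have {h} /eqP : a i * (dot c x - dot c (p i)) = 0.
      apply: h => // j _; rewrite mulr_ge0 ?subr_ge0 ?tmax//; exact: pS.
    by rewrite mulf_eq0 (negPf ai) subr_eq0 => /eqP->.
  by rewrite xE; apply: eq_bigr => i _; case: eqP => // ->; rewrite !scale0r.
move=> Tx; split.
  by apply: conv_hull_subset Tx => s [].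
have [s [sS smax]] := conv_hull_nonempty Tx.
move=> y Py; apply: (le_trans (conv_hull_max_le smax Py)).
have : dot (- c) x <= - dot c s.
  by apply: conv_hull_le Tx => t [tS tmax]; rewrite dotNl lerN2 tmax.
by rewrite dotNl lerN2.
Qed.

Lemma strict_max_vertex c p : p \in S ->
  (forall s, s \in S -> s != p -> dot c s < dot c p) -> max_face P c = [set p].
Proof.
move=> pS pmax; rewrite max_face_conv_hull -[RHS]conv_hull1; congr conv_hull.
apply/seteqP; split=> [s [sS smax]|_ ->].
  have [//|sp] := eqVneq s p.
  by have := pmax s sS sp; rewrite ltNge smax.
by split=> // t tS; have [->//|tp] := eqVneq t p; apply/ltW/pmax.
Qed.

Lemma vertexP p : vertices P p <->
  p \in S /\ exists c, forall s, s \in S -> s != p -> dot c s < dot c p.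
Proof.
split=> [[_ [c pE]]|[pS [c pmax]]]; last first.
  split; first by exists p.
  by exists c; rewrite (strict_max_vertex pS pmax).
have : max_face P c p by rewrite -pE.
rewrite max_face_conv_hull => /conv_hull_nonempty[s Ts].
have sp : s = p.
  suff : max_face P c s by rewrite -pE.
  by rewrite max_face_conv_hull; apply: subset_conv_hull.
rewrite -sp; case: Ts => sS smax; split=> //; exists c => t tS.
apply: contraNT; rewrite -leNgt => st; rewrite sp.
suff : max_face P c t by rewrite -pE => ->.
rewrite max_face_conv_hull; apply: subset_conv_hull; split=> // u uS.
exact: le_trans (smax _ uS) st.
Qed.

Definition differences : seq 'rV[R]_d := [seq x - y | x <- S, y <- S].

Lemma differences_inj c :
  (forall w, w \in differences -> w != 0 -> dot c w != 0) ->
  {in S &, injective (dot c)}.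
Proof.
move=> cd x y xS yS /eqP; rewrite -subr_eq0 -dotBr; apply: contraTeq.
by rewrite -subr_eq0; apply: cd; apply: allpairs_f.
Qed.

Lemma inj_max_vertex c p : p \in S -> {in S &, injective (dot c)} ->
  (forall s, s \in S -> dot c s <= dot c p) ->
  forall s, s \in S -> s != p -> dot c s < dot c p.
Proof.
move=> pS cinj pmax s sS sp; rewrite lt_neqAle pmax// andbT.
by apply: contra sp => /eqP/cinj->.
Qed.

Lemma generic_separation (ws : seq 'rV[R]_d) x : ~ P x ->
  exists c, [/\ forall s, s \in S -> dot c s < dot c x,
    {in S &, injective (dot c)} &
    forall w, w \in ws -> w != 0 -> dot c w != 0].
Proof.
move=> /conv_hull_separation[c0 c0S].
have [|c cS cw] := @generic_perturbation R d [seq x - s | s <- S] (differences ++ ws) c0.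
  by move=> _ /mapP[s sS ->]; apply: c0S.
exists c; split.
- by move=> s sS; rewrite -subr_gt0 -dotBr; apply: cS; apply: map_f.
- by apply: differences_inj => w wD; apply: cw; rewrite mem_cat wD.
- by move=> w wD; apply: cw; rewrite mem_cat wD orbT.
Qed.

(** A functional separating [x] from the vertices can be made injective on [S]. Its maximiser on [S]
    is then a vertex, and its value there is at least that at [x]. *)
Lemma conv_hull_vertices : P `<=` conv_hull (vertices P).
Proof.
move=> x Px; pose V := [seq s <- S | `[< vertices P s >]].
apply: (@conv_hull_subset _ _ [set` V]).
  by move=> s /=; rewrite mem_filter => /andP[/asboolP].
apply: contrapT => /conv_hull_separation[c0 c0V].
have [|c cV cw] := @generic_perturbation R d [seq x - s | s <- V] differences c0.
  by move=> _ /mapP[s sS ->]; apply: c0V.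
have cinj := differences_inj cw.
have [s0 s0S _] := conv_hull_exposed c Px.
have [s sS smax] := seq_argmax (dot c) s0S.
have sV : s \in V.
  rewrite mem_filter sS andbT; apply/asboolP/vertexP; split=> //; exists c.
  exact: inj_max_vertex.
have : 0 < dot c (x - s) by apply: cV; apply: map_f.
by rewrite dotBr subr_gt0 ltNge (conv_hull_max_le smax).
Qed.

(** [c] is interior to the normal cone of its face, relative to the functionals constant on that
    face: generators off the face stay strictly below it under a small change, and those on it
    remain tied. *)
Lemma normal_cone_perturbation c w f : max_face P c f ->
  (forall x y, max_face P c x -> max_face P c y -> dot w x = dot w y) ->
  exists2 t, 0 < t & normal_cone P (max_face P c) (c + t *: w).
Proof.
move=> Ff wF.
have [|t t0 tS] := @small_perturbation R d
    [seq f - s | s <- [seq s <- S | dot c s < dot c f]] c w.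
  move=> _ /mapP[s + ->]; rewrite mem_filter dotBr subr_gt0.
  by move=> /andP[].
exists t => // x Fx; split; first by case: Fx.
have fx : dot (c + t *: w) f = dot (c + t *: w) x.
  rewrite !dotDl !dotZl (wF _ _ Ff Fx); congr (_ + _).
  by apply/eqP; rewrite eq_le; case: Ff Fx => Pf fm [Px xm]; rewrite fm// xm.
move=> y Py; have [s sS ys] := conv_hull_exposed (c + t *: w) Py.
apply: (le_trans ys); rewrite -fx.
have [sf|fs] := ltP (dot c s) (dot c f).
  rewrite ltW// -subr_gt0 -dotBr; apply: tS; apply: map_f.
  by rewrite mem_filter sf.
have Fs : max_face P c s.
  split; first exact: subset_conv_hull.
  by move=> z Pz; apply: le_trans fs; case: Ff => _; apply.
rewrite !dotDl !dotZl (wF _ _ Fs Ff) lerD2r.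
by case: Ff => _; apply; case: Fs.
Qed.

(* Ratio test of the simplex method along the segment from [c0] to [c1]: it is
   generic for [c0] that the face on which it leaves the normal cone of [p] is an
   edge. *)
Lemma improving_edge p c1 s0 : vertices P p -> {in S &, injective (dot c1)} ->
  s0 \in S -> dot c1 p < dot c1 s0 ->
  exists p' c, [/\ vertices P p', dot c1 p < dot c1 p' &
    max_face P c = conv_hull [set p; p']].
Proof.
move=> /vertexP[pS [c00 c00p]] c1inj s0S ps0.
(* [c0] vanishes on such a vector when [s] and [e] have the same ratio in the test below. Genericity
   then makes the vector zero, so that generators leaving simultaneously are collinear with [p]. *)
pose W := [seq dot c1 (p - e) *: (p - s) - dot c1 (p - s) *: (p - e) | s <- S, e <- S].
have [|c0 c0us c0W] := @generic_perturbation R d [seq p - s | s <- S & s != p] W c00.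
  move=> _ /mapP[s + ->]; rewrite mem_filter => /andP[sp sS].
  by rewrite dotBr subr_gt0 c00p.
have c0p s : s \in S -> s != p -> 0 < dot c0 (p - s).
  by move=> sS sp; apply: c0us; apply: map_f; rewrite mem_filter sp.
pose T := [seq s <- S | dot c1 p < dot c1 s].
(* [m] has the least ratio, so [tau] is the largest parameter for which [c0 + tau *: c1] is still
   maximal at [p]. *)
have [|m] := seq_argmax (fun s => - (dot c0 (p - s) / dot c1 (s - p))) (_ : s0 \in T).
  by rewrite mem_filter ps0.
rewrite mem_filter => /andP[pm mS] mmin.
have c1m : 0 < dot c1 (m - p) by rewrite dotBr subr_gt0.
have mp : m != p by apply: contraTneq pm => ->; rewrite ltxx.
pose tau := dot c0 (p - m) / dot c1 (m - p).
have tau0 : 0 < tau by rewrite divr_gt0// c0p.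
pose c := c0 + tau *: c1.
have cE s : dot c (p - s) = dot c0 (p - s) - tau * dot c1 (s - p).
  by rewrite dotDl dotZl -(opprB p s) dotNr mulrN opprK.
have cp s : s \in S -> 0 <= dot c (p - s).
  move=> sS; have [->|sp] := eqVneq s p; first by rewrite subrr dot0r.
  rewrite cE; have [sp1|ps1] := leP (dot c1 s) (dot c1 p).
    rewrite subr_ge0 (@le_trans _ _ 0) ?(ltW (c0p _ sS sp))//.
    by rewrite mulr_ge0_le0 ?(ltW tau0)// dotBr subr_le0.
  have := mmin s; rewrite mem_filter ps1 sS lerN2 => /(_ isT).
  by rewrite ler_pdivlMr ?dotBr ?subr_gt0// -!dotBr subr_ge0.
have cm : dot c (p - m) = 0 by rewrite cE divfK ?subrr// gt_eqF.
pose tie s := dot c (p - s) == 0.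
have tie_gt s : s \in S -> tie s -> s != p -> dot c1 p < dot c1 s.
  move=> sS /eqP + sp; rewrite cE => /eqP; rewrite subr_eq0 => /eqP h.
  have := c0p s sS sp; rewrite h pmulr_rgt0// dotBr subr_gt0//.
(* The tied generators are those on the face of [c]; the one highest for [c1] is the far end of the
   edge. *)
have [|q] := seq_argmax (dot c1) (_ : m \in [seq s <- S | tie s]).
  by rewrite mem_filter mS /tie cm eqxx.
rewrite mem_filter => /andP[tq qS] qmax.
have pq : dot c1 p < dot c1 q.
  by apply: (lt_le_trans pm); apply: qmax; rewrite mem_filter mS /tie cm eqxx.
exists q, c; split=> //.
  apply/vertexP; split=> //.
  have cpq s : dot c (q - s) = dot c (p - s).
    by move/eqP: tq; rewrite !dotBr => h; lra.
  (* A small multiple of [c1] keeps untied generators strictly below [q] and breaks the ties in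
     favour of [q], so [c + t *: c1] exposes [q]. *)
  have [|t t0 tu] := @small_perturbation R d [seq q - s | s <- S & ~~ tie s] c c1.
    move=> _ /mapP[s + ->]; rewrite mem_filter => /andP[ts sS].
    by rewrite cpq lt_def ts cp.
  exists (c + t *: c1) => s sS sq; rewrite -subr_gt0 -dotBr.
  have [ts|ts] := boolP (tie s); last first.
    by apply: tu; apply: map_f; rewrite mem_filter ts.
  rewrite dotDl dotZl cpq (eqP ts) add0r mulr_gt0// dotBr subr_gt0.
  rewrite lt_neqAle qmax ?mem_filter ?ts// andbT.
  by apply: contra sq => /eqP/c1inj->.
rewrite max_face_conv_hull; apply/seteqP; split; last first.
  apply: conv_hull_subset => s [->|->]; split=> // t tS.
    by rewrite -subr_ge0 -dotBr cp.
  by move: (cp t tS) (eqP tq); rewrite !dotBr => h1 h2; lra.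
move=> x Tx.
have TS : [set s | s \in S /\ forall t, t \in S -> dot c t <= dot c s] `<=`
    [set` [seq s <- S | tie s]].
  move=> s [sS smax] /=; rewrite mem_filter sS andbT /tie eq_le cp// andbT.
  by rewrite dotBr subr_le0 smax.
have Tpq s : s \in [seq s <- S | tie s] ->
    exists2 t, 0 <= t <= 1 & s = p + t *: (q - p).
  move=> sT; move: (sT); rewrite mem_filter => /andP[ts sS].
  have [->|sp] := eqVneq s p.
    by exists 0; rewrite ?lexx ?ler01// scale0r addr0.
  have ps := tie_gt s sS ts sp; have sq := qmax s sT.
  have qp0 : 0 < dot c1 (q - p) by rewrite dotBr subr_gt0.
  exists (dot c1 (s - p) / dot c1 (q - p)).
    rewrite divr_ge0 ?(ltW qp0)//; last by rewrite dotBr subr_ge0 ltW.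
    by rewrite ler_pdivrMr// mul1r !dotBr lerD2r.
  (* Both [s] and [q] are tied, so [c0] vanishes on this element of [W]. *)
  have : dot c1 (p - q) *: (p - s) - dot c1 (p - s) *: (p - q) = 0.
    apply/eqP/negPn/negP => w0.
    have /eqP := c0W _ (allpairs_f _ sS qS) w0; apply.
    move: (eqP ts) (eqP tq); rewrite !cE !dotE => h1 h2.
    have -> : dot c0 p = dot c0 s + tau * (dot c1 s - dot c1 p) by lra.
    have -> : dot c0 q = dot c0 s + tau * (dot c1 s - dot c1 p)
      - tau * (dot c1 q - dot c1 p) by lra.
    by ring.
  move/subr0_eq => h.
  apply/eqP; rewrite addrC -subr_eq; apply/eqP.
  apply: (scalerI (lt0r_neq0 qp0)); rewrite scalerA mulrC divfK ?gt_eqF//.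
  move: h; rewrite -(opprB q p) -(opprB s p) !dotNr !scalerN !scaleNr !opprK => h.
  exact: h.
apply/conv_hull2P.
have {}Tx := conv_hull_subset TS Tx.
case: Tx => n [r [a [rT a0 a1 ->]]].
have /(@choice _ _ (fun i t => 0 <= t <= 1 /\ r i = p + t *: (q - p)))[t tr] :
    forall i, exists t, 0 <= t <= 1 /\ r i = p + t *: (q - p).
  by move=> i; have [t t01 ->] := Tpq _ (rT i); exists t.
exists (\sum_i a i * t i).
  apply/andP; split; last by apply: wavg_le => // i; case: (tr i) => /andP[].
  by apply: sumr_ge0 => i _; rewrite mulr_ge0//; case: (tr i) => /andP[].
rewrite scaler_suml -{1}[p]scale1r -a1 scaler_suml -big_split.
by apply: eq_bigr => i _ /=; rewrite -scalerA -scalerDr; case: (tr i) => _ ->.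
Qed.

End Polytope.


(** * Lattice lengths of segments *)

Section LatticeLength.
Variables (R : realType) (d : nat).

Lemma biggcdn_mul n (F : 'I_n -> nat) m :
  (\big[gcdn/0]_i F i * m = \big[gcdn/0]_i (F i * m))%N.
Proof.
by apply: (big_morph (muln^~ m)) => [x y|]; rewrite ?muln_gcdl ?mul0n.
Qed.

Lemma primitive_neq0 (u : 'rV[int]_d) : primitive u -> exists j, u 0 j != 0.
Proof.
move=> pu; apply: contrapT => no; move: pu; rewrite /primitive big1// => i _.
by have [->//|ui] := eqVneq (u 0 i) 0; case: no; exists i.
Qed.

(** Proportionality gives [u i * u' j = u' i * u j]; taking the gcd over [i] yields
    [|u' j| = |u j|], and comparing the [j]-th coordinates yields the claim. *)
Lemma primitive_scale (u u' : 'rV[int]_d) (k k' : R) :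
  primitive u -> primitive u' -> k *: int_vec R u = k' *: int_vec R u' ->
  `|k| = `|k'|.
Proof.
move=> pu pu' E.
have Ei i : k * (u 0 i)%:~R = k' * (u' 0 i)%:~R.
  by have /rowP/(_ i) := E; rewrite !mxE.
have [j uj] := primitive_neq0 pu; have [j' uj'] := primitive_neq0 pu'.
have [k0|k0] := eqVneq k 0.
  move: (Ei j'); rewrite k0 mul0r => /esym/eqP; rewrite mulf_eq0 intr_eq0 (negPf uj') orbF.
  by move=> /eqP->.
have [k'0|k'0] := eqVneq k' 0.
  move: (Ei j); rewrite k'0 mul0r => /eqP; rewrite mulf_eq0 intr_eq0 (negPf uj) orbF.
  by move=> /eqP->.
have cross i : u 0 i * u' 0 j = u' 0 i * u 0 j.
  apply: (@intr_inj R); rewrite !intrM; apply: (mulfI (mulf_neq0 k0 k'0)).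
  by rewrite mulrACA (Ei i) -(Ei j); ring.
have abs_eq : `|u' 0%R j|%N = `|u 0%R j|%N.
  have := biggcdn_mul (fun i => `|u 0%R i|%N) `|u' 0%R j|%N.
  have := biggcdn_mul (fun i => `|u' 0%R i|%N) `|u 0%R j|%N.
  rewrite [X in (X * _)%N = _]pu' [X in _ -> (X * _)%N = _ -> _]pu !mul1n => -> ->.
  by apply: eq_bigr => i _; rewrite -!abszM cross.
have := congr1 Num.norm (Ei j); rewrite !normrM -!intr_norm -!abszE abs_eq.
by apply: mulIf; rewrite intr_eq0 eqz_nat absz_eq0.
Qed.

(** The choice made by [xget] is harmless: other endpoints change the edge vector only by a sign,
    and another primitive vector leaves [|k|] unchanged. *)
Lemma lattice_length_segment (v w : 'rV[R]_d) (u : 'rV[int]_d) (k : R) :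
  v != w -> primitive u -> w - v = k *: int_vec R u ->
  lattice_length (conv_hull [set v; w]) = `|k|.
Proof.
move=> vw pu wv; rewrite /lattice_length; set L := [set l | _].
have : L (xget 0 L) by apply: xgetPex; exists `|k|, v, w, u, k.
move=> [v' [w' [u' [k' [E pu' wv' ->]]]]].
have [e e1 we] := conv_hull_endpoints vw E.
rewrite (primitive_scale pu' pu (_ : _ = (e * k) *: _)) ?normrM ?e1 ?mul1r//.
by rewrite -wv' we wv scalerA.
Qed.

(** Multiplying by the product [D] of the denominators gives an integer vector [z]; dividing by the
    gcd [g] of its entries makes it primitive. *)
Lemma primitive_direction (x : 'rV[rat]_d) : x != 0 ->
  exists (u : 'rV[int]_d) (k : R), primitive u /\ map_mx ratr x = k *: int_vec R u.
Proof.
move=> x0; pose D := \prod_j denq (x 0 j).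
pose z i := numq (x 0 i) * \prod_(j | j != i) denq (x 0 j).
have D0 : D != 0 by apply/prodf_neq0 => j _; rewrite denq_eq0.
have zE i : (z i)%:~R = x 0 i * D%:~R.
  by rewrite /z /D [in RHS](bigD1 i)//= !intrM numqE mulrA.
pose g := \big[gcdn/0%N]_i `|z i|%N.
have g_dvd i : (g %| z i)%Z by rewrite dvdzE /= (biggcdn_inf i).
have g0 : g != 0%N.
  apply: contra x0 => /eqP g0; apply/eqP/rowP => i; rewrite mxE.
  have := g_dvd i; rewrite g0 dvd0z => /eqP zi.
  have /eqP := zE i; rewrite zi eq_sym mulf_eq0 intr_eq0 (negPf D0) orbF.
  by move=> /eqP.
exists (\row_i (z i %/ g)%Z), (g%:R / D%:~R); split.
  have : (\big[gcdn/0]_i `|((\row_i0 (z i0 %/ g)%Z) : 'rV_d) 0%R i| * g = 1 * g)%N.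
    rewrite biggcdn_mul mul1n; apply: eq_bigr => i _.
    by rewrite mxE -[g in (_ * g)%N]absz_nat -abszM divzK.
  by move=> /eqP; rewrite eqn_pmul2r ?lt0n// => /eqP.
apply/rowP => i; rewrite !mxE.
have h : (z i)%:~R = ((z i %/ g)%Z)%:~R * g%:R :> R.
  by rewrite -[g%:R]/((g%:Z)%:~R) -intrM divzK.
have := congr1 (ratr : rat -> R) (zE i); rewrite [in RHS]rmorphM /= !ratr_int h => h'.
rewrite mulrAC [g%:R * _]mulrC h' mulfK// intr_eq0//.
Qed.

Lemma has_dim_segment (v w : 'rV[R]_d) :
  v != w -> has_dim (conv_hull [set v; w]) 1.
Proof.
move=> vw; exists v, (<<w - v>>)%MS; split.
  by rewrite genmxE rank_rV subr_eq0 eq_sym vw.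
apply/seteqP; split=> [_ [n [p [a [pE a1 ->]]]]|_ [u uU <-]].
  have /(@choice _ _ (fun i t => p i = v + t *: (w - v)))[t tE] :
      forall i, exists t, p i = v + t *: (w - v).
    by move=> i; have /conv_hull2P[t _ ->] := pE i; exists t.
  exists ((\sum_i a i * t i) *: (w - v)).
    by rewrite /= genmxE; apply/sub_rVP; exists (\sum_i a i * t i).
  rewrite scaler_suml -{1}[v]scale1r -a1 scaler_suml -big_split.
  by apply: eq_bigr => i _ /=; rewrite -scalerA -scalerDr tE.
move: uU; rewrite /= genmxE => /sub_rVP[k ->].
exists 2%N, (fun i => if i == ord0 then v else w),
  (fun i => if i == ord0 then 1 - k else k); split.
- by move=> i; apply: subset_conv_hull; case: ifP; [left|right].
- by rewrite big_ord_recl big_ord1 /= subrK.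
- rewrite big_ord_recl big_ord1 /= scalerBl scalerBr scale1r -!addrA; congr (_ + _).
  by rewrite addrC.
Qed.

End LatticeLength.

(** * Refinement of normal fans *)

Section NormalFans.
Variables (R : realType) (d : nat) (S T : seq 'rV[R]_d).
Implicit Types (c p q w x y : 'rV[R]_d).
Let P := conv_hull [set` S].
Let Q := conv_hull [set` T].
Hypothesis PQ : refines (normal_fan P) (normal_fan Q).

(** Refinement only provides some face [G] of [Q]. As [c - c0] is constant on the face of [P],
    moving from [c] slightly away from [c0] stays in its normal cone, hence in that of [G]. So on
    the face of [Q] at [c], [c0] is at least its value on [G], which is maximal. *)
Lemma normal_cone_max_face c : max_face P c !=set0 ->
  normal_cone P (max_face P c) `<=` normal_cone Q (max_face Q c).
Proof.
move=> [f Ff] c0 c0F.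
have [|_ [G [[g Gg] _] ->] FG] := PQ (C := normal_cone P (max_face P c)).
  by exists (max_face P c) => //; split; [exists f|exists c].
have wF x y : max_face P c x -> max_face P c y -> dot (c - c0) x = dot (c - c0) y.
  move=> Fx Fy; have [_ x0] := c0F _ Fx; have [_ y0] := c0F _ Fy.
  case: Fx Fy => Px x1 [Py y1].
  have := x1 y Py; have := y1 x Px; have := x0 y Py; have := y0 x Px.
  by rewrite !dotBl; lra.
have [t t0 /FG tG] := normal_cone_perturbation Ff wF.
have [Qg gmax] := FG _ c0F _ Gg; have [_ gmaxc] := FG c (fun _ h => h) _ Gg.
move=> q [Qq qmax]; split=> // y Qy; apply: (le_trans (gmax y Qy)).
have [_ /(_ q Qq)] := tG _ Gg; rewrite !dotDl !dotZl => h.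
have cqg : dot c q = dot c g by apply/eqP; rewrite eq_le gmaxc ?qmax.
move: h; rewrite cqg lerD2l ler_pM2l// !dotBl cqg; lra.
Qed.

(** Minimality holds because a cone of [Q] containing the normal cone of the face of [P] contains
    [c], so its face lies in [max_face Q c]. Two least cones contain each other, which determines
    the face. *)
Lemma Phi_max_face c : max_face P c !=set0 -> max_face Q c !=set0 ->
  Phi P Q (max_face P c) = max_face Q c.
Proof.
move=> F0 G0; rewrite /Phi; set X := [set G | _].
have faceG : face Q (max_face Q c) by split=> //; exists c.
have GX : X (max_face Q c).
  split=> //; first exact: normal_cone_max_face.
  move=> _ [H [_ _] ->] FH c1 c1G x Hx.
  by apply: c1G; apply: (FH c) Hx.
have : X (xget set0 X) by apply: xgetPex; exists (max_face Q c).
move: (xget set0 X) => _ [[_ [c1 ->]] FG Gmin].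
apply/seteqP; split; first exact: (FG c).
apply: (Gmin (normal_cone Q (max_face Q c))) => //; first by exists (max_face Q c).
exact: normal_cone_max_face.
Qed.

(** A functional exposing [p] can be chosen injective on [T], so that it also exposes a single
    vertex [q] of [Q]; [normal_cone_max_face] covers all other functionals. *)
Lemma vertex_image p : Q !=set0 -> vertices P p ->
  exists2 q, vertices Q q & forall c, max_face P c p -> max_face Q c q.
Proof.
move=> [y Qy] /vertexP[pS [c0 c0p]].
have [|c cS cT] := @generic_perturbation R d [seq p - s | s <- S & s != p] (differences T) c0.
  move=> _ /mapP[s + ->]; rewrite mem_filter => /andP[sp sS].
  by rewrite dotBr subr_gt0 c0p.
have cinj := differences_inj cT.
have pE : max_face P c = [set p].
  apply: strict_max_vertex => // s sS sp; rewrite -subr_gt0 -dotBr.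
  by apply: cS; apply: map_f; rewrite mem_filter sp.
have [q0 q0T _] := conv_hull_exposed c Qy.
have [q qT qmax] := seq_argmax (dot c) q0T.
have qstrict := inj_max_vertex qT cinj qmax.
exists q; first by apply/vertexP; split=> //; exists c.
move=> c1 c1p; have : normal_cone Q (max_face Q c) c1.
  by apply: normal_cone_max_face; rewrite pE; [exists p|move=> _ ->].
by apply; rewrite (strict_max_vertex qT qstrict).
Qed.

Lemma vertex_strict_max (A : set 'rV[R]_d) q : vertices A q ->
  exists c, forall x, A x -> x != q -> dot c x < dot c q.
Proof.
move=> [_ [c qE]]; exists c => x Ax xq.
have [_ qmax] : max_face A c q by rewrite -qE.
rewrite lt_neqAle qmax// andbT; apply: contra xq => /eqP xq; apply/eqP.
suff : max_face A c x by rewrite -qE.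
by split=> // y Ay; rewrite xq qmax.
Qed.

Lemma segment_sub_conv_hull (U : seq 'rV[R]_d) x y : conv_hull [set` U] x ->
  conv_hull [set` U] y -> conv_hull [set x; y] `<=` conv_hull [set` U].
Proof.
move=> Ux Uy z xyz; apply: contrapT => /conv_hull_separation[c cU].
have [s sU xs] := conv_hull_exposed c Ux; have [t tU yt] := conv_hull_exposed c Uy.
have [m mU mmax] := seq_argmax (dot c) sU.
have := cU m mU; rewrite dotBr subr_gt0 ltNge => /negP; apply.
apply: conv_hull_le xyz => _ [->|->].
  exact: le_trans xs (mmax _ sU).
exact: le_trans yt (mmax _ tU).
Qed.

(** A functional [w] orthogonal to [p' - p] is constant on the edge, so both [c] and [c + t *: w]
    lie in its normal cone. Both are then constant on the face of [Q], so [w] is too, and that face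
    lies on a line parallel to [p' - p]. *)
Lemma edge_image c p p' q q' : p != p' -> max_face P c = conv_hull [set p; p'] ->
  vertices Q q -> vertices Q q' -> q != q' -> max_face Q c q -> max_face Q c q' ->
  exists2 t, q' - q = t *: (p' - p) & max_face Q c = conv_hull [set q; q'].
Proof.
move=> pp' FE vq vq' qq' Gq Gq'.
have F0 : max_face P c !=set0.
  by exists p; rewrite FE; apply: subset_conv_hull; left.
have line x : max_face Q c x -> exists t, x - q = t *: (p' - p).
  move=> Gx; apply: orth_orth_colinear => [|w w0]; first by rewrite subr_eq0 eq_sym.
  case: (F0) => f Ff.
  have [|t t0 tF] := @normal_cone_perturbation _ _ _ c w _ Ff.
    move=> y z; rewrite -/P FE => /conv_hull2P[a _ ->] /conv_hull2P[b _ ->].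
    by rewrite ![dot w (p + _)]dotDr !dotZr w0 !mulr0.
  have tG := normal_cone_max_face F0 tF.
  have [_ q1] := tG _ Gq; have [_ x1] := tG _ Gx.
  case: Gq Gx => Qq q0 [Qx x0].
  have cqx : dot c x = dot c q by apply/eqP; rewrite eq_le q0 ?x0.
  have := q1 x Qx; have := x1 q Qq; rewrite !dotDl !dotZl cqx !lerD2l !ler_pM2l//.
  by rewrite dotBr => h1 h2; apply/eqP; rewrite subr_eq0 eq_le h2 h1.
have [t tE] := line q' Gq'; exists t => //.
have t0 : t != 0.
  by apply: contra qq' => /eqP t0; rewrite eq_sym -subr_eq0 tE t0 scale0r.
have [[Qq qm] [Qq' q'm]] := (Gq, Gq').
apply/seteqP; split=> x.
  move=> Gx; have [s sE] := line x Gx.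
  have xE : x = q + (s / t) *: (q' - q).
    by rewrite tE scalerA divfK// -sE addrC subrK.
  apply/conv_hull2P; exists (s / t) => //.
  have Qx : Q x by case: Gx.
  have hle (c1 v : 'rV[R]_d) : (forall x, Q x -> x != v -> dot c1 x < dot c1 v) ->
      dot c1 x <= dot c1 v.
    by move=> h; have [->//|xv] := eqVneq x v; apply/ltW/h.
  (* A functional exposing [q] rules out parameters below [0], and one exposing [q'] rules out
     parameters above [1]. *)
  have [c1 h1] := vertex_strict_max vq; have [c2 h2] := vertex_strict_max vq'.
  apply/andP; split.
    have := hle _ _ h1; have : dot c1 q' < dot c1 q by apply: h1; rewrite // eq_sym.
    rewrite xE dotDr dotZr dotBr => a b; rewrite leNgt; apply/negP => c0.
    have : 0 < s / t * (dot c1 q' - dot c1 q) by rewrite nmulr_rgt0// subr_lt0.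
    by lra.
  have := hle _ _ h2; have : dot c2 q < dot c2 q' by apply: h2.
  rewrite xE dotDr dotZr dotBr => a b; rewrite leNgt; apply/negP => c0.
  have : 0 < (s / t - 1) * (dot c2 q' - dot c2 q) by rewrite mulr_gt0 ?subr_gt0.
  by lra.
move=> xqq'; split; first exact: segment_sub_conv_hull xqq'.
have qq'c : dot c q' = dot c q by apply/eqP; rewrite eq_le qm ?q'm.
have /conv_hull2P[a _ ->] := xqq'; move=> y Qy.
by rewrite dotDr dotZr dotBr qq'c subrr mulr0 addr0 qm.
Qed.

End NormalFans.


Lemma sub_count_lt (U : eqType) (a1 a2 : pred U) (s : seq U) (x : U) :
  subpred a1 a2 -> x \in s -> a2 x -> ~~ a1 x -> (count a1 s < count a2 s)%N.
Proof.
move=> a12 xs a2x na1x.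
have -> : count a1 s = count a1 (filter a2 s).
  rewrite count_filter; apply: eq_count => y /=.
  by have := a12 y; case: (a1 y) => // ->.
rewrite -(size_filter a2) ltn_neqAle count_size andbT -all_count; apply/allPn.
by exists x; rewrite ?mem_filter ?a2x.
Qed.

Lemma vertices_subset (R : realType) (d : nat) (A : set 'rV[R]_d) :
  vertices A `<=` A.
Proof. by move=> v [_ [c E]]; have [] : max_face A c v by rewrite -E. Qed.

(** * The Minkowski summand *)

Section LongEdges.
Variables (R : realType) (d : nat) (S T : seq 'rV[R]_d).
Implicit Types (c p x y : 'rV[R]_d).
Let P := conv_hull [set` S].
Let Q := conv_hull [set` T].
Hypothesis ratS : forall s, s \in S -> exists r : 'rV[rat]_d, s = map_mx ratr r.
Hypothesis PQ : refines (normal_fan P) (normal_fan Q).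
Hypothesis long : forall E, edge P E -> edge Q (Phi P Q E) ->
  d%:R * lattice_length (Phi P Q E) <= lattice_length E.

(** Rationality of [p] and [p'] gives a primitive [u] with [p' - p = k *: u]. The two lattice
    lengths are then [|k|] and [|t * k|], so the length condition reads [d * |t| <= 1]. *)
Lemma edge_image_ratio c p p' q q' : p != p' -> p \in S -> p' \in S ->
  max_face P c = conv_hull [set p; p'] -> vertices Q q -> vertices Q q' ->
  max_face Q c q -> max_face Q c q' ->
  exists2 t, q' - q = t *: (p' - p) & d%:R * t <= 1.
Proof.
move=> pp' pS p'S FE vq vq' Gq Gq'.
(* An edge that collapses to a vertex of [Q] is outside the length condition; the ratio is [0]. *)
have [qq'|qq'] := eqVneq q q'.
  by exists 0; rewrite ?mulr0// qq' subrr scale0r.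
have [t tE GE] := edge_image PQ pp' FE vq vq' qq' Gq Gq'; exists t => //.
have F0 : max_face P c !=set0.
  by exists p; rewrite FE; apply: subset_conv_hull; left.
have G0 : max_face Q c !=set0 by exists q.
have [[r rE] [r' r'E]] := (ratS pS, ratS p'S).
have [|u [k [pu rk]]] := @primitive_direction R d (r' - r).
  by apply: contra pp' => /eqP/subr0_eq rr'; rewrite rE r'E rr'.
have pk : p' - p = k *: int_vec R u by rewrite -rk rE r'E map_mxB.
have k0 : 0 < `|k|.
  rewrite normr_gt0; apply: contra pp' => /eqP k0.
  by rewrite eq_sym -subr_eq0 pk k0 scale0r.
have := long (E := max_face P c); rewrite (Phi_max_face PQ F0 G0).
rewrite /edge FE GE (lattice_length_segment pp' pu pk).
rewrite (@lattice_length_segment _ _ q q' u (t * k))//; last first.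
  by rewrite tE pk scalerA.
have eP : edge P (conv_hull [set p; p']).
  by split; [rewrite -FE; split=> //; exists c|exact: has_dim_segment].
have eQ : edge Q (conv_hull [set q; q']).
  by split; [rewrite -GE; split=> //; exists c|exact: has_dim_segment].
move=> /(_ eP eQ); rewrite normrM mulrA -ler_pdivlMr// divff ?gt_eqF//.
by apply: le_trans; rewrite ler_wpM2l// ler_norm.
Qed.

Variable q : 'rV[R]_d -> 'rV[R]_d.
Hypothesis qP : forall p, vertices P p ->
  vertices Q (q p) /\ forall c, max_face P c p -> max_face Q c (q p).
Let r p := p - d%:R *: q p.

Lemma residual_max c p0 p : {in S &, injective (dot c)} -> p0 \in S ->
  (forall s, s \in S -> dot c s <= dot c p0) ->
  vertices P p -> dot c (r p) <= dot c (r p0).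
Proof.
move=> cinj p0S p0max.
(* Each improving edge lowers the number of generators strictly above the current vertex, so the
   walk ends, at [p0]. *)
have [n] := ubnP (count (fun s => dot c p < dot c s) S).
elim: n p => // n IH p nlt vp.
have pS : p \in S by case/vertexP: vp.
have [p0p|pp0] := leP (dot c p0) (dot c p).
  suff -> : p = p0 by [].
  by apply: cinj => //; apply/eqP; rewrite eq_le p0max.
have [p' [c' [vp' pp' FE]]] := improving_edge vp cinj p0S pp0.
have p'S : p' \in S by case/vertexP: vp'.
have Fp : max_face P c' p by rewrite FE; apply: subset_conv_hull; left.
have Fp' : max_face P c' p' by rewrite FE; apply: subset_conv_hull; right.
have [[vq qF] [vq' qF']] := (qP vp, qP vp').
have np : p != p' by apply: contraTneq pp' => <-; rewrite ltxx.
have [t tE dt] := edge_image_ratio np pS p'S FE vq vq' (qF _ Fp) (qF' _ Fp').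
apply: le_trans (IH p' _ vp').
  rewrite -subr_ge0 -dotBr.
  have -> : r p' - r p = (1 - d%:R * t) *: (p' - p).
    rewrite scalerBl scale1r -scalerA -tE /r scalerBr.
    by apply/rowP => i; rewrite !mxE; ring.
  by rewrite dotZr mulr_ge0 ?subr_ge0// dotBr subr_ge0 ltW.
rewrite -ltnS; apply: leq_trans nlt; rewrite ltnS.
apply: (@sub_count_lt _ _ _ S p') => //; last by rewrite ltxx.
by move=> s /=; apply: lt_trans.
Qed.

(** Under a separating [c] with maximiser [p0], the residuals contribute at most [dot c (r p0)]. The
    rest contributes at most [d] times [dot c (q p0)]: the gap of [v i0] below [q p0] enters with
    weight [(d + 1) * b i0 >= 1], which pays for subtracting [v i0]. The two bounds add up to
    [dot c p0]. *)
Lemma residual_vertices_sum n (v : 'I_n -> 'rV[R]_d) (b : 'I_n -> R) i0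
    m (a : 'I_m -> R) (p : 'I_m -> 'rV[R]_d) :
  (forall i, vertices Q (v i)) -> (forall i, 0 <= b i) -> \sum_i b i = 1 ->
  1 <= d.+1%:R * b i0 ->
  (forall j, vertices P (p j)) -> (forall j, 0 <= a j) -> \sum_j a j = 1 ->
  P (\sum_j a j *: r (p j) + (d.+1%:R *: (\sum_i b i *: v i) - v i0)).
Proof.
move=> vQ b0 b1 bi0 pP a0 a1; set x := _ + _.
apply: contrapT => /(generic_separation [::])[c [cx cinj _]].
(* Weights summing to one force [0 < m], which provides a generator of [P]. *)
have [s0 s0S] : [set` S] !=set0.
  case: m a p pP a0 a1 x cx => [a p _ _|m a p pP _ _ _ _].
    by rewrite big_ord0 => /eqP; rewrite eq_sym oner_eq0.
  by exists (p ord0); case/vertexP: (pP ord0).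
have [p0 p0S p0max] := seq_argmax (dot c) s0S.
have vp0 : vertices P p0.
  by apply/vertexP; split=> //; exists c; exact: inj_max_vertex.
have [_ /(_ c) qF] := qP vp0.
have [_ qmax] : max_face Q c (q p0).
  apply: qF; split; first exact: subset_conv_hull.
  by move=> y; apply: conv_hull_max_le.
have {}qmax i : dot c (v i) <= dot c (q p0) by apply: qmax; exact: vertices_subset.
have rle : \sum_j a j * dot c (r (p j)) <= dot c (r p0).
  by apply: wavg_le => // j; apply: residual_max.
have bge : b i0 * (dot c (q p0) - dot c (v i0)) <=
    \sum_i b i * (dot c (q p0) - dot c (v i)).
  rewrite (bigD1 i0)//= lerDl sumr_ge0// => i _.
  by rewrite mulr_ge0// subr_ge0.
have := cx p0 p0S; rewrite ltNge => /negP; apply.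
rewrite /x dotDr dot_sumr dotBr dotZr dot_sumr.
have E : \sum_i b i * (dot c (q p0) - dot c (v i)) =
    dot c (q p0) - \sum_i b i * dot c (v i).
  by under eq_bigr do rewrite mulrBr; rewrite sumrB -mulr_suml b1 mul1r.
have h : dot c (q p0) - dot c (v i0) <=
    d.+1%:R * (dot c (q p0) - \sum_i b i * dot c (v i)).
  rewrite -E; apply: le_trans (ler_wpM2l _ bge); last exact: ler0n.
  by rewrite mulrA ler_peMl// subr_ge0.
have pr : dot c p0 = dot c (r p0) + d%:R * dot c (q p0).
  by rewrite /r dotBr dotZr subrK.
rewrite pr -natr1 in h *; lra.
Qed.

Lemma long_edges_vertex_sum x : minkowski_sum Q P x ->
  minkowski_sum (vertices Q) P x.
Proof.
move=> [y Qy [z Pz <-]].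
have [m [p [a [pP a0 a1 zE]]]] := conv_hull_vertices Pz.
(* Splitting each [p j] as [r (p j) + d *: q (p j)] leaves [y] together with [d] times a point of
   [Q]. This is [(d + 1) *: y2], where [y2] is an average of points of [Q]. *)
pose y2 := d.+1%:R^-1 *: (y + d%:R *: \sum_j a j *: q (p j)).
have d0 : 0 < d.+1%:R :> R by rewrite ltr0n.
have Qy2 : Q y2.
  apply: contrapT => /conv_hull_separation[c cT].
  have [t0 t0T _] := conv_hull_exposed c Qy.
  have [t tT tmax] := seq_argmax (dot c) t0T.
  have yt : dot c y <= dot c t by apply: conv_hull_max_le Qy.
  have qt : \sum_j a j * dot c (q (p j)) <= dot c t.
    apply: wavg_le => // j; apply: (conv_hull_max_le tmax).
    by apply: vertices_subset; case: (qP (pP j)).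
  have := cT t tT; rewrite dotBr subr_gt0 ltNge => /negP; apply.
  rewrite dotZr dotDr dotZr dot_sumr ler_pdivrMl// -natr1.
  have : d%:R * (\sum_j a j * dot c (q (p j))) <= d%:R * dot c t.
    by rewrite ler_wpM2l.
  by lra.
have [n [v [b [i0 [bi0 [vQ b0 b1 y2E]]]]]] :=
  caratheodory_weight (conv_hull_vertices Qy2).
exists (v i0); first exact: vQ.
exists (y + z - v i0); last by rewrite addrC subrK.
have -> : y + z - v i0 =
    \sum_j a j *: r (p j) + (d.+1%:R *: (\sum_i b i *: v i) - v i0).
  rewrite -y2E /y2 scalerA divff ?gt_eqF// scale1r /r.
  under [in RHS]eq_bigr do rewrite scalerBr scalerA mulrC -scalerA.
  rewrite sumrB -scaler_sumr -zE addrA; congr (_ - _).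
  by rewrite [in RHS](addrC y) addrA subrK addrC.
exact: residual_vertices_sum.
Qed.

End LongEdges.

(** * From vertex translates to convex normality *)

Theorem mainTheorem8 (R : realType) (d : nat) (P Q : set 'rV[R]_d)
  (ratP : rational_polytope P) (ratQ : rational_polytope Q)
  (dimP : has_dim P d) (dimQ : has_dim Q d)
  (PQ : refines (normal_fan P) (normal_fan Q))
  (long : forall E : set 'rV[R]_d, edge P E -> edge Q (Phi P Q E) ->
     d%:R * lattice_length (Phi P Q E) <= lattice_length E) :
  convex_normal Q P.
Proof.
have ratE (s : seq 'rV[rat]_d) :
    [set (map_mx ratr q : 'rV[R]_d) | q in [set` s]] = [set` map (map_mx ratr) s].
  apply/seteqP; split=> [_ [r rs <-]|x /mapP[r rs ->]]; last by exists r.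
  exact: map_f.
case: ratP ratQ => [s PE] [t QE]; rewrite ratE in PE; rewrite ratE in QE.
subst P Q; set P := conv_hull _ in PQ long *; set Q := conv_hull _ in PQ long *.
apply/seteqP; split=> [x Hx|_ [g [v _ [_ Qg]] [z Pz <-]]]; last first.
  by exists g => //; exists z.
have Q0 : Q !=set0 by case: Hx => y Qy _; exists y.
have /(@choice _ _ (fun p q => vertices P p ->
    vertices Q q /\ forall c, max_face P c p -> max_face Q c q))[q qP] :
    forall p, exists q, vertices P p ->
    vertices Q q /\ forall c, max_face P c p -> max_face Q c q.
  move=> p; have [vp|vp] := pselect (vertices P p).
    by have [q vq qF] := vertex_image PQ Q0 vp; exists q.
  (* Default value at points that are not vertices of [P]. *)
  by exists 0.
have ratS (u : 'rV[R]_d) : u \in map (map_mx ratr) s ->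
    exists r : 'rV[rat]_d, u = map_mx ratr r.
  by move=> /mapP[r _ ->]; exists r.
have [v vQ [z Pz <-]] := long_edges_vertex_sum ratS PQ long qP Hx.
exists v; last by exists z.
exists v => //; split; last exact: vertices_subset.
(* A vertex is its own translate by the zero integer vector, so it belongs to [G(Q)]. *)
by exists 0 => //; apply/rowP => i; rewrite !mxE addr0.
Qed.
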